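(* Let $Y\in\mathbb{R}^{m\times N}$ be such that $Y^\dagger=Y^T(YY^T)^{-1}$ exists, and denote $H_Y=Y^\dagger Y$. Let $R\in\mathbb{R}^{m\times N}$, $\lambda\in\mathbb{R}^N$ with $\lambda\ge0$, $\nu\in\mathbb{R}$ and $\alpha,\beta\ge0$. Consider the problem $$\min_{d\in\mathbb{R}^m:\ \|d\|=1,\ p\in\mathbb{R}^{1\times m}}\ \frac12\|d\,pY-R\|_F^2+\beta\|pY\|_2+\alpha\|pY\|_1-\nu\,pY\lambda .$$ Then a solution $(d^+,p^+)$ (global minimizer) of this problem is given by: $(d^+,\tau_1(d^+),\tau_2(d^+))$ is a solution of the min-max problem $$\min_{\|d\|=1}\ \max_{\tau_1,\tau_2\in\mathbb{R}^N:\ \|\tau_2\|_2\le1,\ \|\tau_1\|_\infty\le1}\ -\frac12\|R^Td+\nu\lambda-\alpha\tau_1-\beta\tau_2\|_{H_Y}^2,$$ and $$p^+=\bigl(R^Td^++\nu\lambda-\beta\tau_2(d^+)-\alpha\tau_1(d^+)\bigr)^TY^\dagger .$$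
   Context: $\|\cdot\|$, $\|\cdot\|_2$ denote the Euclidean norm, $\|\cdot\|_1$ and $\|\cdot\|_\infty$ the $\ell_1$ and $\ell_\infty$ vector norms, $\|\cdot\|_F$ the Frobenius norm, and $\|v\|_{H}^2=v^THv$ for a symmetric positive semidefinite matrix $H$. A solution $(d^+,\tau_1(d^+),\tau_2(d^+))$ of the min-max problem means: $d^+$ minimizes over the unit sphere the value of the inner maximum, and $(\tau_1(d^+),\tau_2(d^+))$ attains the inner maximum at $d=d^+$. Background: this is one K-SVD-type step for the dictionary pair learning (DPL) / one-class SVM (OC-SVM) objective $\frac12\|Y-DPY\|_F^2+\beta\sum_i\|p^iY\|_2+\sum_i\alpha_i\|p^iY\|_1+G(PY,\omega,\rho,\xi)$, where $d=d_i$ is a unit-norm column of the synthesis dictionary $D$, $p=p^i$ is the corresponding row of the analysis dictionary $P$, $\alpha=\alpha_i$, $R=Y-\sum_{j\neq i}d_jp^jY$ is the residual without the pair $(d_i,p^i)$, $\nu=\omega_i$ is the component of the OC-SVM normal vector $\omega$ corresponding to $d_i$, and $\lambda$ is the vector of OC-SVM Lagrange multipliers. *)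

(* Defs.v *)
From mathcomp Require Import all_boot all_order all_algebra.
From mathcomp Require Import boolp classical_sets reals topology normedtype.
Import Order.TTheory GRing.Theory Num.Theory numFieldNormedType.Exports.

Set Implicit Arguments.
Unset Strict Implicit.
Unset Printing Implicit Defensive.

Local Open Scope classical_set_scope.
Local Open Scope ring_scope.

(* The library norm [`|A|] of a matrix is the maximum of the absolute values
   of its entries; on column vectors it is the l_infinity norm used below.
   The two other entrywise norms are: *)

(* the Frobenius norm, which on row and column vectors is the Euclidean norm *)
Definition norm2 (R : realType) (m n : nat) (A : 'M[R]_(m, n)) : R :=
  Num.sqrt (\sum_(i < m) \sum_(j < n) A i j ^+ 2).

(* and the entrywise l_1 norm, only used on vectors. *)
Definition norm1 (R : realType) (m n : nat) (A : 'M[R]_(m, n)) : R :=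
  \sum_(i < m) \sum_(j < n) `|A i j|.

Definition sqnormH (R : realType) (n : nat) (H : 'M[R]_n) (v : 'cV[R]_n) : R :=
  (v^T *m H *m v) 0 0.

(* [invmx] is the inverse only when [Y *m Y^T \in unitmx]. *)
Definition right_pinv (R : realType) (m N : nat) (Y : 'M[R]_(m, N)) :
    'M[R]_(N, m) :=
  Y^T *m invmx (Y *m Y^T).

Definition HY (R : realType) (m N : nat) (Y : 'M[R]_(m, N)) : 'M[R]_N :=
  right_pinv Y *m Y.

Section Problem.
Variables (R : realType) (m N : nat) (Y Res : 'M[R]_(m, N)).
Variables (lambda : 'cV[R]_N) (nu alpha beta : R).

Definition pair_cost (d : 'cV[R]_m) (p : 'rV[R]_m) : R :=
  2^-1 * norm2 (d *m p *m Y - Res) ^+ 2 + beta * norm2 (p *m Y)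
  + alpha * norm1 (p *m Y) - nu * (p *m Y *m lambda) 0 0.

Definition pair_minimizer (d : 'cV[R]_m) (p : 'rV[R]_m) : Prop :=
  norm2 d = 1 /\
  forall (d' : 'cV[R]_m) (p' : 'rV[R]_m),
    norm2 d' = 1 -> pair_cost d p <= pair_cost d' p'.

Definition minmax_cost (d : 'cV[R]_m) (tau1 tau2 : 'cV[R]_N) : R :=
  - (2^-1 * sqnormH (HY Y)
              (Res^T *m d + nu *: lambda - alpha *: tau1 - beta *: tau2)).

Definition tau_feasible (tau1 tau2 : 'cV[R]_N) : Prop :=
  norm2 tau2 <= 1 /\ `|tau1| <= 1.

Definition inner_maximizer (d : 'cV[R]_m) (tau1 tau2 : 'cV[R]_N) : Prop :=
  tau_feasible tau1 tau2 /\
  forall tau1' tau2' : 'cV[R]_N, tau_feasible tau1' tau2' ->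
    minmax_cost d tau1' tau2' <= minmax_cost d tau1 tau2.

(* The value of the inner maximum.  When [Y *m Y^T] is invertible, [HY Y] is
   an orthogonal projector, so the set is bounded above by 0 and this is a
   genuine supremum; it is attained since the feasible set is compact. *)
Definition inner_value (d : 'cV[R]_m) : R :=
  sup [set v | exists tau1 tau2 : 'cV[R]_N,
    tau_feasible tau1 tau2 /\ v = minmax_cost d tau1 tau2].

Definition minmax_solution (d : 'cV[R]_m) (tau1 tau2 : 'cV[R]_N) : Prop :=
  [/\ norm2 d = 1,
      forall d' : 'cV[R]_m, norm2 d' = 1 -> inner_value d <= inner_value d' &
      inner_maximizer d tau1 tau2].

End Problem.

(* Main.v *)
Require Import Defs.
From mathcomp Require Import all_boot all_order all_algebra.
From mathcomp Require Import boolp classical_sets reals topology normedtype.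
From mathcomp Require Import ring lra.
Import Order.TTheory GRing.Theory Num.Theory numFieldNormedType.Exports.

Local Open Scope ring_scope.

(* Put q = pY, c = R^T d + nu lambda and v = c - alpha tau_1 - beta tau_2.  For
   ||d|| = 1 the cost is ||q||^2/2 - q c + beta ||q||_2 + alpha ||q||_1 up to
   the constant ||R||_F^2/2.  Since q tau_2 <= ||q||_2, q tau_1 <= ||q||_1 and
   q H_Y = q, with H_Y an orthogonal projector, it is at least
   ||q||^2/2 - q v >= - ||v||_{H_Y}^2/2, the min-max cost.  If (tau_1, tau_2)
   is an inner maximizer and q = v^T H_Y, first-order optimality over the
   convex feasible set forces alpha q tau_1 + beta q tau_2
   = alpha ||q||_1 + beta ||q||_2, so both bounds are equalities.  A solution
   of the min-max problem exists by compactness, the inner value being lower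
   semicontinuous in d as a supremum of continuous functions. *)

(** * Euclidean, l_1 and l_infinity norms: convexity of unit balls and dual pairings *)

Section Norms.
Variable R : realType.

Lemma norm2_ge0 m n (A : 'M[R]_(m, n)) : 0 <= norm2 A.
Proof. exact: sqrtr_ge0. Qed.

Lemma sqr_norm2 m n (A : 'M[R]_(m, n)) :
  norm2 A ^+ 2 = \sum_i \sum_j A i j ^+ 2.
Proof.
by rewrite sqr_sqrtr//; apply: sumr_ge0 => i _; apply: sumr_ge0 => j _;
  exact: sqr_ge0.
Qed.

Lemma norm2_le1 m n (A : 'M[R]_(m, n)) :
  (norm2 A <= 1) = (\sum_i \sum_j A i j ^+ 2 <= 1).
Proof. by rewrite -sqr_norm2 expr_le1// norm2_ge0. Qed.

Lemma norm2_mxtrace m n (A : 'M[R]_(m, n)) : norm2 A ^+ 2 = \tr (A^T *m A).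
Proof.
rewrite sqr_norm2 exchange_big; apply: eq_bigr => j _; rewrite !mxE.
by apply: eq_bigr => i _; rewrite !mxE expr2.
Qed.

Lemma norm2_row n (q : 'rV[R]_n) : norm2 q ^+ 2 = (q *m q^T) 0 0.
Proof. by rewrite norm2_mxtrace mxtrace_mulC /mxtrace big_ord1. Qed.

Lemma norm2_col n (t : 'cV[R]_n) : norm2 t ^+ 2 = (t^T *m t) 0 0.
Proof. by rewrite norm2_mxtrace /mxtrace big_ord1. Qed.

Lemma norm2_le1_entry m n (A : 'M[R]_(m, n)) i j : norm2 A <= 1 -> `|A i j| <= 1.
Proof.
rewrite norm2_le1 => A1.
rewrite -(@ler_sqr R)// ?nnegrE// expr1n real_normK ?num_real//.
apply: le_trans A1; rewrite (bigD1 i)//= (bigD1 j)//= -addrA lerDl.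
by rewrite addr_ge0//; apply: sumr_ge0 => k _; [|apply: sumr_ge0 => l _];
  exact: sqr_ge0.
Qed.

Lemma mx_norm_le m n (A : 'M[R]_(m, n)) (c : R) :
  0 <= c -> (`|A| <= c) <-> (forall i j, `|A i j| <= c).
Proof.
move=> c0; rewrite [`|A|]/Num.norm/= mx_normrE; split.
  by move=> /bigmax_leP[_ H] i j; exact: (H (i, j)).
by move=> H; apply/bigmax_leP; split.
Qed.

Lemma norm2_le1_convex m n (A B : 'M[R]_(m, n)) (s : R) : 0 <= s <= 1 ->
  norm2 A <= 1 -> norm2 B <= 1 -> norm2 (A + s *: (B - A)) <= 1.
Proof.
move=> /andP[s0 s1]; rewrite !norm2_le1 => A1 B1.
suff: \sum_i \sum_j (A + s *: (B - A)) i j ^+ 2 <=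
    (1 - s) * (\sum_i \sum_j A i j ^+ 2) + s * (\sum_i \sum_j B i j ^+ 2).
  by move=> H; apply: (le_trans H); nra.
rewrite !mulr_sumr -big_split; apply: ler_sum => i _.
rewrite !mulr_sumr -big_split; apply: ler_sum => j _ /=; rewrite !mxE.
(* This is exactly the convexity gap of the square at one entry. *)
have : 0 <= s * (1 - s) * (A i j - B i j) ^+ 2.
  apply: mulr_ge0 (sqr_ge0 _); apply: mulr_ge0 => //; lra.
by move=> H; rewrite -subr_ge0; move: H; congr (_ <= _); ring.
Qed.

Lemma mx_norm_le1_convex m n (A B : 'M[R]_(m, n)) (s : R) : 0 <= s <= 1 ->
  `|A| <= 1 -> `|B| <= 1 -> `|A + s *: (B - A)| <= 1.
Proof.
move=> /andP[s0 s1] A1 B1.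
have -> : A + s *: (B - A) = (1 - s) *: A + s *: B.
  by rewrite scalerBl scalerBr scale1r -addrA [- _ + _]addrC.
rewrite (le_trans (ler_normD _ _))// !normrZ !ger0_norm ?subr_ge0//.
nra.
Qed.

(** Restricted forms of [mxE] that split linear combinations while keeping matrix products
    folded. *)
Lemma add_mxE m n (A B : 'M[R]_(m, n)) i j : (A + B) i j = A i j + B i j.
Proof. by rewrite mxE. Qed.

Lemma sub_mxE m n (A B : 'M[R]_(m, n)) i j : (A - B) i j = A i j - B i j.
Proof. by rewrite !mxE. Qed.

Lemma scale_mxE m n (a : R) (A : 'M[R]_(m, n)) i j : (a *: A) i j = a * A i j.
Proof. by rewrite mxE. Qed.

Lemma norm2_eq0 m n (A : 'M[R]_(m, n)) : norm2 A = 0 -> A = 0.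
Proof.
move=> A0; apply/matrixP => i j; rewrite mxE; apply/eqP; rewrite -normr_le0.
have : norm2 A ^+ 2 = 0 by rewrite A0 expr0n.
rewrite sqr_norm2 => /eqP; rewrite psumr_eq0 => [|k _]; last first.
  by apply: sumr_ge0 => l _; exact: sqr_ge0.
move=> /allP/(_ i (mem_index_enum _))/=.
rewrite psumr_eq0 => [/allP/(_ j (mem_index_enum _))/=|k _]; last exact: sqr_ge0.
by rewrite sqrf_eq0 => /eqP ->; rewrite normr0.
Qed.

(** Cauchy-Schwarz: with a = ||q||, expanding 0 <= ||q - a t^T||^2 and using ||t|| <= 1 gives a (q
    t) <= a^2, and a cancels unless it is 0. *)
Lemma mulmx_le_norm2 n (q : 'rV[R]_n) (t : 'cV[R]_n) :
  norm2 t <= 1 -> (q *m t) 0 0 <= norm2 q.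
Proof.
move=> t1; set a := norm2 q.
have [a0|a0] := eqVneq a 0; first by rewrite (norm2_eq0 _ _ q a0) mul0mx mxE a0.
have a_gt0 : 0 < a by rewrite lt_neqAle eq_sym a0 norm2_ge0.
have := sqr_ge0 (norm2 (q - a *: t^T)); rewrite norm2_row.
rewrite [(_ - _)^T]linearB/= [(_ *: _)^T]linearZ/= trmxK.
rewrite !mulmxBl !mulmxBr -!scalemxAl -!scalemxAr.
have qtE : (t^T *m q^T) 0 0 = (q *m t) 0 0 by rewrite -trmx_mul mxE.
have {}t1 : norm2 t ^+ 2 <= 1 by rewrite expr_le1// norm2_ge0.
rewrite !sub_mxE.
rewrite !scale_mxE -norm2_row -norm2_col qtE -/a => H.
rewrite -(ler_pM2l a_gt0); nra.
Qed.

(** Normalizing q^T gives equality in Cauchy-Schwarz; q = 0 is treated apart because of the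
    division. *)
Lemma mulmx_norm2_attained n (q : 'rV[R]_n) :
  exists2 t : 'cV[R]_n, norm2 t <= 1 & (q *m t) 0 0 = norm2 q.
Proof.
have [q0|q0] := eqVneq (norm2 q) 0.
  exists 0; last by rewrite mulmx0 mxE q0.
  by rewrite norm2_le1 big1// => i _; rewrite big1// => j _; rewrite mxE expr0n.
exists ((norm2 q)^-1 *: q^T); last first.
  by rewrite -scalemxAr mxE -norm2_row expr2 mulKf.
rewrite -(@ler_sqr R) ?nnegrE ?norm2_ge0// norm2_col [(_ *: _)^T]linearZ/= trmxK.
rewrite -scalemxAr -scalemxAl scalerA mxE -norm2_row -expr2 exprVn.
by rewrite mulVf ?sqrf_eq0// expr1n.
Qed.

Lemma norm1_row n (q : 'rV[R]_n) : norm1 q = \sum_j `|q 0 j|.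
Proof. by rewrite /norm1 big_ord1. Qed.

Lemma mulmx_le_norm1 n (q : 'rV[R]_n) (t : 'cV[R]_n) :
  `|t| <= 1 -> (q *m t) 0 0 <= norm1 q.
Proof.
move=> /(mx_norm_le _ _ t 1 ler01) t1; rewrite norm1_row mxE.
apply: ler_sum => j _.
by rewrite (le_trans (ler_norm _))// normrM ler_piMr.
Qed.

(** The sign vector of q turns each product into an absolute value. *)
Lemma mulmx_norm1_attained n (q : 'rV[R]_n) :
  exists2 t : 'cV[R]_n, `|t| <= 1 & (q *m t) 0 0 = norm1 q.
Proof.
exists (\col_j Num.sg (q 0 j)).
  by apply/mx_norm_le => // i j; rewrite mxE normr_sg; case: (_ != _).
rewrite norm1_row mxE; apply: eq_bigr => j _.
by rewrite mxE mulrC -normrEsg.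
Qed.

End Norms.

(** * Weak and strong duality for a fixed unit vector d *)

Section Duality.
Variables (R : realType) (m N : nat) (Y Res : 'M[R]_(m, N)).
Variables (lambda : 'cV[R]_N) (nu alpha beta : R).
Hypothesis Y_pinv : Y *m Y^T \in unitmx.
Hypotheses (alpha_ge0 : 0 <= alpha) (beta_ge0 : 0 <= beta).

Lemma mulmx_right_pinv : Y *m right_pinv Y = 1%:M.
Proof. by rewrite /right_pinv mulmxA mulmxV. Qed.

Lemma mulmx_HY : Y *m HY Y = Y.
Proof. by rewrite /HY mulmxA mulmx_right_pinv mul1mx. Qed.

Lemma trmx_HY : (HY Y)^T = HY Y.
Proof.
by rewrite /HY /right_pinv !trmx_mul trmx_inv trmx_mul !trmxK mulmxA.
Qed.

Lemma HY_idem : HY Y *m HY Y = HY Y.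
Proof. by rewrite {1}/HY -mulmxA mulmx_HY. Qed.

(** A symmetric idempotent H equals H H^T, so the seminorm is the Euclidean norm of a projected
    row. *)
Lemma sqnormH_HY (v : 'cV[R]_N) :
  sqnormH (HY Y) v = norm2 (v^T *m HY Y) ^+ 2.
Proof.
rewrite norm2_row trmx_mul trmxK trmx_HY mulmxA.
by rewrite -[_ *m HY Y *m HY Y]mulmxA HY_idem.
Qed.

Let c (d : 'cV[R]_m) : 'cV[R]_N := Res^T *m d + nu *: lambda.
Let v (d : 'cV[R]_m) (t1 t2 : 'cV[R]_N) : 'cV[R]_N :=
  c d - alpha *: t1 - beta *: t2.

(** Since d^T d = 1, the quadratic term of ||d q - Res||^2 is ||q||^2, so d enters only through the
    linear coefficient [c d]. *)
Lemma pair_costE (d : 'cV[R]_m) (p : 'rV[R]_m) (q := p *m Y) : norm2 d = 1 ->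
  pair_cost Y Res lambda nu alpha beta d p =
  2^-1 * norm2 q ^+ 2 - (q *m c d) 0 0 + beta * norm2 q + alpha * norm1 q
  + 2^-1 * norm2 Res ^+ 2.
Proof.
move=> d1; rewrite /pair_cost -mulmxA -/q.
have dd : d^T *m d = 1%:M.
  by rewrite [_ *m _]mx11_scalar -norm2_col d1 expr1n.
have -> : norm2 (d *m q - Res) ^+ 2 =
    norm2 q ^+ 2 - 2 * (q *m Res^T *m d) 0 0 + norm2 Res ^+ 2.
  rewrite !norm2_mxtrace [(_ - _)^T]linearB/= trmx_mul mulmxBl !mulmxBr.
  rewrite -[q^T *m d^T *m (_ *m _)]mulmxA [d^T *m (_ *m _)]mulmxA dd mul1mx.
  rewrite !linearB/=.
  have -> : \tr (q^T *m d^T *m Res) = (q *m Res^T *m d) 0 0.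
    rewrite -mxtrace_tr !trmx_mul !trmxK mulmxA mxtrace_mulC mulmxA.
    by rewrite /mxtrace big_ord1.
  have -> : \tr (Res^T *m (d *m q)) = (q *m Res^T *m d) 0 0.
    by rewrite mulmxA mxtrace_mulC mulmxA /mxtrace big_ord1.
  ring.
rewrite /c mulmxDr -scalemxAr mulmxA !add_mxE !scale_mxE.
by field; rewrite ?pnatr_eq0.
Qed.

Lemma minmax_costE d t1 t2 : minmax_cost Y Res lambda nu alpha beta d t1 t2 =
  - (2^-1 * norm2 ((v d t1 t2)^T *m HY Y) ^+ 2).
Proof. by rewrite /minmax_cost sqnormH_HY. Qed.

Lemma weak_duality d p t1 t2 : norm2 d = 1 -> tau_feasible t1 t2 ->
  minmax_cost Y Res lambda nu alpha beta d t1 t2 + 2^-1 * norm2 Res ^+ 2 <=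
  pair_cost Y Res lambda nu alpha beta d p.
Proof.
move=> d1 [t2_le1 t1_le1]; rewrite pair_costE// minmax_costE.
set q := p *m Y; set w := v d t1 t2.
have qH : q *m HY Y = q by rewrite -mulmxA mulmx_HY.
have H2 := mulmx_le_norm2 _ _ q _ t2_le1.
have H1 := mulmx_le_norm1 _ _ q _ t1_le1.
have {}H2 := ler_wpM2l beta_ge0 H2.
have {}H1 := ler_wpM2l alpha_ge0 H1.
have qc : (q *m c d) 0 0 =
    (q *m w) 0 0 + alpha * (q *m t1) 0 0 + beta * (q *m t2) 0 0.
  rewrite /w /v !mulmxBr -!scalemxAr.
  rewrite !sub_mxE.
  rewrite !scale_mxE; ring.
clearbody w.
(* Half of this square is the duality gap left once the two norm bounds are applied; both cross
   terms are q w because [HY Y] is symmetric and q [HY Y] = q. *)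
have : norm2 (q - w^T *m HY Y) ^+ 2 =
    norm2 q ^+ 2 - 2 * (q *m w) 0 0 + norm2 (w^T *m HY Y) ^+ 2.
  rewrite norm2_row [(q - _)^T]linearB/= !mulmxBl !mulmxBr.
  rewrite !sub_mxE.
  rewrite -!norm2_row.
  have -> : (w^T *m HY Y *m q^T) 0 0 = (q *m w) 0 0.
    by rewrite -mulmxA -[HY Y]trmx_HY -trmx_mul qH -trmx_mul mxE.
  have -> : (q *m (w^T *m HY Y)^T) 0 0 = (q *m w) 0 0.
    by rewrite trmx_mul trmxK trmx_HY mulmxA qH.
  ring.
have := sqr_ge0 (norm2 (q - w^T *m HY Y)).
rewrite qc; lra.
Qed.

Lemma tau_feasible_convex (t1 t2 t1' t2' : 'cV[R]_N) (s : R) : 0 <= s <= 1 ->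
  tau_feasible t1 t2 -> tau_feasible t1' t2' ->
  tau_feasible (t1 + s *: (t1' - t1)) (t2 + s *: (t2' - t2)).
Proof.
move=> s01 [H1 H2] [H3 H4]; split; first exact: norm2_le1_convex.
exact: mx_norm_le1_convex.
Qed.

(** A step s towards a feasible competitor changes [v] by - s w, so the directional derivative of
    the min-max cost is q w, which cannot be positive at a maximizer. *)
Lemma inner_maximizer_variational d t1 t2 t1' t2'
    (q := (v d t1 t2)^T *m HY Y) :
  inner_maximizer Y Res lambda nu alpha beta d t1 t2 -> tau_feasible t1' t2' ->
  alpha * (q *m t1') 0 0 + beta * (q *m t2') 0 0 <=
  alpha * (q *m t1) 0 0 + beta * (q *m t2) 0 0.
Proof.
move=> [ft maxt] ft'.
pose w := alpha *: (t1' - t1) + beta *: (t2' - t2).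
suff : (q *m w) 0 0 <= 0.
  rewrite /w mulmxDr -!scalemxAr !mulmxBr.
  rewrite !add_mxE !scale_mxE.
  rewrite !sub_mxE; lra.
(* Optimality against a step of length s towards the competitor. *)
have key (s : R) : 0 <= s <= 1 ->
    2 * s * (q *m w) 0 0 <= s ^+ 2 * norm2 (w^T *m HY Y) ^+ 2.
  move=> s01.
  have := maxt _ _ (tau_feasible_convex _ _ _ _ _ s01 ft ft').
  rewrite !minmax_costE -/q.
  have -> : (v d (t1 + s *: (t1' - t1)) (t2 + s *: (t2' - t2)))^T *m HY Y =
      q - s *: (w^T *m HY Y).
    rewrite scalemxAl -mulmxBl -linearZ -linearB; congr (_^T *m _).
    by apply/matrixP => i j; rewrite /v /w !mxE; ring.
  rewrite lerN2 ler_pM2l ?invr_gt0 ?ltr0n// [X in _ <= X -> _]norm2_row.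
  rewrite [(_ - _)^T]linearB/= [(_ *: _)^T]linearZ/=.
  rewrite !mulmxBl !mulmxBr -!scalemxAl -!scalemxAr.
  rewrite !sub_mxE.
  rewrite !scale_mxE -!norm2_row.
  have -> : (q *m (w^T *m HY Y)^T) 0 0 = (q *m w) 0 0.
    by rewrite trmx_mul trmxK trmx_HY mulmxA -[_ *m HY Y *m HY Y]mulmxA HY_idem.
  have -> : (w^T *m HY Y *m q^T) 0 0 = (q *m w) 0 0.
    rewrite -mulmxA -[HY Y]trmx_HY -trmx_mul -[_ *m HY Y *m HY Y]mulmxA HY_idem.
    by rewrite -trmx_mul mxE.
  lra.
rewrite leNgt; apply/negP => x_gt0.
have : 0 <= norm2 (w^T *m HY Y) ^+ 2 by exact: sqr_ge0.
move: (norm2 _ ^+ 2) ((q *m w) 0 0) key x_gt0 => C x key x_gt0 C_ge0.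
(* s = x / (x + C) lies in [0, 1] and makes s C < 2 x. *)
have xC : 0 < x + C by lra.
have s01 : 0 <= x / (x + C) <= 1.
  apply/andP; split; first exact: divr_ge0 (ltW _) (ltW _).
  by rewrite ler_pdivrMr// mul1r lerDl.
have s_gt0 : 0 < x / (x + C) by rewrite divr_gt0.
have := key _ s01.
have : x / (x + C) * C <= x by rewrite mulrAC ler_pdivrMr//; nra.
nra.
Qed.

Lemma strong_duality d t1 t2 : norm2 d = 1 ->
  inner_maximizer Y Res lambda nu alpha beta d t1 t2 ->
  pair_cost Y Res lambda nu alpha beta d ((v d t1 t2)^T *m right_pinv Y) =
  minmax_cost Y Res lambda nu alpha beta d t1 t2 + 2^-1 * norm2 Res ^+ 2.
Proof.
move=> d1 maxt; apply/eqP; rewrite eq_le weak_duality//; last by case: maxt.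
rewrite andbT pair_costE// minmax_costE -mulmxA -/(HY Y).
set w := v d t1 t2; set q := w^T *m HY Y.
(* Competitors attaining both norms of q turn the variational inequality into the reverse of the
   norm bounds used for weak duality. *)
have [t2' t2'_le1 t2'E] := mulmx_norm2_attained _ _ q.
have [t1' t1'_le1 t1'E] := mulmx_norm1_attained _ _ q.
have : tau_feasible t1' t2' by [].
move=> /(inner_maximizer_variational _ _ _ _ _ maxt).
rewrite -/w -/q t1'E t2'E.
have -> : (q *m c d) 0 0 =
    norm2 q ^+ 2 + alpha * (q *m t1) 0 0 + beta * (q *m t2) 0 0.
  have -> : c d = w + alpha *: t1 + beta *: t2.
    by rewrite /w /v addrAC subrK subrK.
  have -> : norm2 q ^+ 2 = (q *m w) 0 0 by rewrite -sqnormH_HY.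
  by rewrite !mulmxDr -!scalemxAr !add_mxE !scale_mxE.
lra.
Qed.

End Duality.

Arguments weak_duality {R m N Y Res lambda nu alpha beta} _ _ _ {d} p {t1 t2}.

(** * Extrema over compact sets *)

Local Open Scope classical_set_scope.
Local Open Scope ring_scope.

(** The sets [B y] are nonempty and nested, hence generate a proper filter on K; a cluster point
    lies in every closed sublevel set of level F y. Closed sublevel sets express lower
    semicontinuity. *)
Lemma compact_lsc_min (R : realType) (T : topologicalType) (K : set T)
    (F : T -> R) :
  compact K -> K !=set0 -> (forall r, closed [set x | F x <= r]) ->
  exists2 x, K x & forall y, K y -> F x <= F y.
Proof.
move=> Kc [x0 Kx0] Fcl.
pose B y := K `&` [set x | F x <= F y].
have FB : ProperFilter (filter_from K B).
  apply: filter_from_proper => [|y Ky]; last by exists y; split => //=.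
  apply: filter_from_filter => [|y z Ky Kz]; first by exists x0.
  have [yz|/ltW zy] := leP (F y) (F z).
    by exists y => // x [Kx /= xy]; do !split => //=; exact: le_trans yz.
  by exists z => // x [Kx /= xz]; do !split => //=; exact: le_trans zy.
have [|x [Kx clx]] := Kc _ FB; first by exists x0 => // x [].
exists x => // y Ky; apply: (Fcl (F y)) => V Vx.
have [||z [[_ Fz] Vz]] := clx (B y) V => //; first by exists y.
by exists z.
Qed.

Lemma compact_continuous_max (R : realType) (T : topologicalType) (K : set T)
    (F : T -> R) :
  compact K -> K !=set0 -> continuous F ->
  exists2 x, K x & forall y, K y -> F y <= F x.
Proof.
move=> Kc K0 Fc.
have [|r|x Kx xmin] := @compact_lsc_min R T K (fun x => - F x) Kc.
- exact: K0.
- rewrite (_ : [set x | _] = F @^-1` [set y | - r <= y]); last first.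
    by apply/seteqP; split => x /=; rewrite lerNl.
  by apply: preimage_closed => [x _|]; [exact: Fc|exact: closed_ge].
by exists x => // y Ky; rewrite -lerN2; exact: xmin.
Qed.

(** * Continuity of matrix operations *)

Section Continuity.
Variables (R : realType) (T : topologicalType).

(** A matrix neighbourhood contains a box of entry neighbourhoods, and finitely many entry
    conditions hold near x simultaneously. *)
Lemma continuous_mx m n (f : T -> 'M[R]_(m, n)) :
  (forall i j, continuous (fun x => f x i j)) -> continuous f.
Proof.
move=> fc x A [P Pfx PA].
have : \forall y \near x, forall i j, P i j (f y i j).
  apply: filter_forall => i; apply: filter_forall => j.
  exact: fc (Pfx i j).
by apply: filterS => y Py; exact: PA.
Qed.

Lemma continuous_mxentry m n (f : T -> 'M[R]_(m, n)) i j :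
  continuous f -> continuous (fun x => f x i j).
Proof.
move=> fc x.
by apply: (@continuous_comp _ _ _ f (fun A : 'M[R]_(m, n) => A i j));
  [exact: fc|exact: coord_continuous].
Qed.

Lemma continuous_sumr (I : finType) (f : I -> T -> R) :
  (forall i, continuous (f i)) -> continuous (fun x => \sum_i f i x).
Proof.
by move=> fc; apply: continuous_big => //; exact: add_continuous.
Qed.

Lemma continuous_mulmx m n p (f : T -> 'M[R]_(m, n)) (g : T -> 'M[R]_(n, p)) :
  continuous f -> continuous g -> continuous (fun x => f x *m g x).
Proof.
move=> fc gc; apply: continuous_mx => i j.
under eq_fun do rewrite mxE.
apply: continuous_sumr => k x.
by apply: continuousM; exact: continuous_mxentry.
Qed.

Lemma continuous_trmx m n (f : T -> 'M[R]_(m, n)) :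
  continuous f -> continuous (fun x => (f x)^T).
Proof.
move=> fc; apply: continuous_mx => i j.
by under eq_fun do rewrite mxE; exact: continuous_mxentry.
Qed.

Lemma continuous_sqr_norm2 m n (f : T -> 'M[R]_(m, n)) :
  continuous f -> continuous (fun x => norm2 (f x) ^+ 2).
Proof.
move=> fc; under eq_fun do rewrite sqr_norm2.
apply: continuous_sumr => i; apply: continuous_sumr => j x.
by under eq_fun do rewrite expr2; apply: continuousM; exact: continuous_mxentry.
Qed.

End Continuity.

(** * Compactness of the unit balls and of the sphere *)

Lemma cV_compact (R : realType) n (c : R) (K : set 'cV[R]_n) :
  closed K -> (forall x i, K x -> `|x i 0| <= c) -> compact K.
Proof.
move=> Kcl K1.
(* A box of row vectors is compact as a product of segments; its image under the continuous
   transposition contains the closed set K. *)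
pose B := [set v : 'rV[R]_n | forall i, v ord0 i \in `[- c, c]].
have Bc : compact B.
  apply: (@rV_compact R n (fun=> `[- c, c]%classic)) => _.
  exact: segment_compact.
apply: (@subclosed_compact _ _ (trmx @` B)) => //; last first.
  move=> x Kx; exists x^T; last by rewrite trmxK.
  by move=> i; rewrite /= mxE in_itv/= -ler_norml; exact: K1.
apply: continuous_compact => //; apply: continuous_subspaceT.
by apply: (@continuous_trmx R 'rV[R]_n 1 n id) => x; exact: cvg_id.
Qed.

Lemma compact_norm2_le1 (R : realType) n :
  compact [set x : 'cV[R]_n | norm2 x <= 1].
Proof.
apply: (@cV_compact R n 1) => [|x i /=]; last exact: norm2_le1_entry.
(* The squared norm defines the same ball and is polynomial in the entries, hence continuous. *)
rewrite (_ : [set x | _] =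
  (fun x : 'cV[R]_n => norm2 x ^+ 2) @^-1` [set y | y <= 1]).
  apply: preimage_closed => [x _|]; last exact: closed_le.
  by apply: (@continuous_sqr_norm2 R 'cV[R]_n n 1 id) => y; exact: cvg_id.
by apply/seteqP; split => x /=; rewrite expr_le1// norm2_ge0.
Qed.

Lemma compact_sphere (R : realType) n :
  compact [set x : 'cV[R]_n | norm2 x = 1].
Proof.
apply: (@cV_compact R n 1) => [|x i /= x1]; last first.
  by apply: norm2_le1_entry; rewrite x1.
rewrite (_ : [set x | _] =
  (fun x : 'cV[R]_n => norm2 x ^+ 2) @^-1` [set y | y = 1]).
  apply: preimage_closed => [x _|]; last exact: closed_eq.
  by apply: (@continuous_sqr_norm2 R 'cV[R]_n n 1 id) => y; exact: cvg_id.
apply/seteqP; split => x /=; first by move=> ->; rewrite expr1n.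
by move/eqP; rewrite sqrp_eq1 ?norm2_ge0// => /eqP.
Qed.

Lemma compact_mx_norm_le1 (R : realType) n :
  compact [set x : 'cV[R]_n | `|x| <= 1].
Proof.
apply: (@cV_compact R n 1) => [|x i /= /mx_norm_le]; last exact.
rewrite (_ : [set x | _] = Num.norm @^-1` [set y | y <= 1])//.
by apply: preimage_closed => [x _|]; [exact: norm_continuous|exact: closed_le].
Qed.

(** The first basis vector is a witness; in dimension 0 the only vector has norm 0. *)
Lemma sphere_nonempty (R : realType) m : (0 < m)%N ->
  exists d : 'cV[R]_m, norm2 d = 1.
Proof.
case: m => // m _; exists (delta_mx 0 0).
apply/eqP; rewrite -(@sqrp_eq1 R) ?norm2_ge0// norm2_col trmx_delta mul_delta_mx.
by rewrite mxE !eqxx.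
Qed.

(** * Existence of inner maximizers and of min-max solutions *)

Section Existence.
Variables (R : realType) (m N : nat) (Y Res : 'M[R]_(m, N)).
Variables (lambda : 'cV[R]_N) (nu alpha beta : R).

(** The arbitrary parameter space T covers both uses: d fixed with the multipliers varying, and the
    multipliers fixed with d varying. *)
Lemma continuous_minmax_cost (T : topologicalType) (d : T -> 'cV[R]_m)
    (t1 t2 : T -> 'cV[R]_N) :
  continuous d -> continuous t1 -> continuous t2 ->
  continuous (fun x =>
    minmax_cost Y Res lambda nu alpha beta (d x) (t1 x) (t2 x)).
Proof.
move=> dc t1c t2c.
pose v x := Res^T *m d x + nu *: lambda - alpha *: t1 x - beta *: t2 x.
have vc : continuous v.
  apply: continuous_mx => i j.
  rewrite /v; under eq_fun do rewrite !sub_mxE add_mxE !scale_mxE.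
  have mc : continuous (fun x => Res^T *m d x).
    by apply: continuous_mulmx => // x; exact: cst_continuous.
  move=> x; apply: cvgB; [apply: cvgB; [apply: cvgD|]|].
  - exact: (@continuous_mxentry R T _ _ _ i j mc).
  - exact: cst_continuous.
  - apply: cvgM; first exact: cst_continuous.
    exact: (@continuous_mxentry R T _ _ _ i j t1c).
  - apply: cvgM; first exact: cst_continuous.
    exact: (@continuous_mxentry R T _ _ _ i j t2c).
move=> x; rewrite /minmax_cost /sqnormH; apply: cvgN.
apply: cvgM; first exact: cst_continuous.
apply: (@continuous_mxentry R T 1 1 (fun y => (v y)^T *m HY Y *m v y) 0 0 _ x).
apply: continuous_mulmx => //.
by apply: continuous_mulmx => [|y]; [exact: continuous_trmx|exact: cst_continuous].
Qed.

Lemma inner_maximizer_exists d :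
  exists t1 t2, inner_maximizer Y Res lambda nu alpha beta d t1 t2.
Proof.
pose K : set ('cV[R]_N * 'cV[R]_N) :=
  [set t | `|t| <= 1] `*` [set t | norm2 t <= 1].
have [|||[t1 t2] [/= t1_le1 t2_le1] tmax] := @compact_continuous_max R _ K
  (fun t => minmax_cost Y Res lambda nu alpha beta d t.1 t.2).
- apply: compact_setX; [exact: compact_mx_norm_le1|exact: compact_norm2_le1].
- exists (0, 0); split => /=; first by rewrite normr0.
  by rewrite norm2_le1 big1// => i _; rewrite big1// => j _; rewrite mxE expr0n.
- apply: continuous_minmax_cost => x.
  + exact: cst_continuous.
  + exact: cvg_fst.
  + exact: cvg_snd.
exists t1, t2; split => // t1' t2' [t2'_le1 t1'_le1].
exact: (tmax (t1', t2')).
Qed.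

(** [sup] is meaningful for a nonempty set bounded above; the maximizer supplies both an element and
    a bound. *)
Lemma inner_valueE d t1 t2 : inner_maximizer Y Res lambda nu alpha beta d t1 t2 ->
  inner_value Y Res lambda nu alpha beta d =
  minmax_cost Y Res lambda nu alpha beta d t1 t2.
Proof.
move=> [ft tmax]; apply/eqP; rewrite eq_le; apply/andP; split.
  apply: ge_sup; first by eexists; exists t1, t2.
  by move=> _ [t1' [t2' [ft' ->]]]; exact: tmax.
apply: ub_le_sup; last by exists t1, t2.
exists (minmax_cost Y Res lambda nu alpha beta d t1 t2).
by move=> _ [t1' [t2' [ft' ->]]]; exact: tmax.
Qed.

Arguments inner_valueE {d t1 t2}.

Lemma inner_value_le d r : inner_value Y Res lambda nu alpha beta d <= r <->
  forall t1 t2, tau_feasible t1 t2 ->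
    minmax_cost Y Res lambda nu alpha beta d t1 t2 <= r.
Proof.
have [t1 [t2 tmax]] := inner_maximizer_exists d.
rewrite (inner_valueE tmax); case: tmax => ft tmax; split; last exact.
by move=> r_ge t1' t2' ft'; apply: le_trans r_ge; exact: tmax.
Qed.

Lemma minmax_solution_exists : (0 < m)%N ->
  exists d t1 t2, minmax_solution Y Res lambda nu alpha beta d t1 t2.
Proof.
move=> m_gt0.
have [||r|d d1 dmin] := @compact_lsc_min R _ [set d : 'cV[R]_m | norm2 d = 1]
  (inner_value Y Res lambda nu alpha beta).
- exact: compact_sphere.
- exact: sphere_nonempty.
(* A sublevel set of a supremum is the intersection of the sublevel sets of its members, each closed
   by continuity in d. *)
- rewrite (_ : [set d | _] = \bigcap_(t in [set t | tau_feasible t.1 t.2])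
    [set d | minmax_cost Y Res lambda nu alpha beta d t.1 t.2 <= r]).
    apply: closed_bigI => t _; rewrite (_ : [set d | _] =
      (fun d => minmax_cost Y Res lambda nu alpha beta d t.1 t.2)
        @^-1` [set y | y <= r])//.
    apply: preimage_closed => [d _|]; last exact: closed_le.
    by apply: (@continuous_minmax_cost _ id (fun=> t.1) (fun=> t.2)) => x;
      [exact: cvg_id|exact: cst_continuous..].
  apply/seteqP; split => d /= => [/inner_value_le H t|H]; first exact: H.
  by apply/inner_value_le => t1 t2; exact: (H (t1, t2)).
have [t1 [t2 tmax]] := inner_maximizer_exists d.
by exists d, t1, t2; split.
Qed.

End Existence.

Arguments inner_valueE {R m N Y Res lambda nu alpha beta d t1 t2}.

Theorem theorem5 (R : realType) (m N : nat) (m_gt0 : (0 < m)%N)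
    (Y Res : 'M[R]_(m, N)) (lambda : 'cV[R]_N) (nu alpha beta : R)
    (Y_pinv : Y *m Y^T \in unitmx)
    (lambda_ge0 : forall i : 'I_N, 0 <= lambda i 0)
    (alpha_ge0 : 0 <= alpha) (beta_ge0 : 0 <= beta) :
  (exists (d : 'cV[R]_m) (tau1 tau2 : 'cV[R]_N),
     minmax_solution Y Res lambda nu alpha beta d tau1 tau2) /\
  (forall (d : 'cV[R]_m) (tau1 tau2 : 'cV[R]_N),
     minmax_solution Y Res lambda nu alpha beta d tau1 tau2 ->
     pair_minimizer Y Res lambda nu alpha beta d
       ((Res^T *m d + nu *: lambda - beta *: tau2 - alpha *: tau1)^T
          *m right_pinv Y)).
Proof.
split; first exact: minmax_solution_exists.
move=> d t1 t2 [d1 dmin tmax]; split => // d' p' d'1.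
(* Swapping the two subtractions gives the form of [v] in [strong_duality]. *)
rewrite -addrA [- _ - _]addrC addrA strong_duality//.
(* An inner maximizer at d' links the chain: up to a common constant, the cost at d is the inner
   value at d, at most the inner value at d', which weak duality bounds by the cost of (d', p'). *)
have [t1' [t2' tmax']] :=
  @inner_maximizer_exists R m N Y Res lambda nu alpha beta d'.
have [ft' _] := tmax'.
apply: le_trans (weak_duality Y_pinv alpha_ge0 beta_ge0 p' d'1 ft').
rewrite lerD2r -(inner_valueE tmax) -(inner_valueE tmax'); exact: dmin.
Qed.
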